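(* Let $r\in\mathbb{C}$ with $\operatorname{Re}(r)>1$. Then the function $f_r(z)=\sum_{n=0}^\infty \frac{z^n}{(n!)^r}$ is entire and has infinitely many zeros in $\mathbb{C}$.
   Context: For a complex exponent $r$, $(n!)^r=\exp(r\ln(n!))$, where $\ln$ is the real natural logarithm of the positive real number $n!$. *)

(* Defs.v *)
From Stdlib Require Import Reals Factorial.
From Stdlib Require Finite_sets.
From Coquelicot Require Export Coquelicot.

Open Scope C_scope.

Definition Cexp (w : C) : C :=
  (RtoC (exp (Re w)) * (cos (Im w), sin (Im w)))%C.

Definition fact_Cpower (n : nat) (r : C) : C :=
  Cexp (r * RtoC (ln (INR (fact n)))).

(** Only meaningful when both real series converge ([Series] is total); users
    should pair it with a proof of [is_series a (CSeries a)]. *)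
Definition CSeries (a : nat -> C) : C :=
  (Series (fun n => Re (a n)), Series (fun n => Im (a n))).

Definition fr_term (r z : C) (n : nat) : C := z ^ n / fact_Cpower n r.

Definition fr (r z : C) : C := CSeries (fr_term r z).

(** [ex_derive] is taken over [C_AbsRing]: the derivative is complex-linear. *)
Definition entire (g : C -> C) : Prop :=
  forall z : C, @ex_derive C_AbsRing C_NormedModule g z.

(* Main.v *)
Require Import Defs.
From Stdlib Require Import Reals.
From Stdlib Require Finite_sets.
From Stdlib Require Import Factorial Lra Lia Classical ClassicalEpsilon.
From Coquelicot Require Import Coquelicot.
Open Scope R_scope.

(** The coefficients [1 / (n!)^r] have modulus [(n!)^(- Re r)]. Since [Re r > 1], they are
    bounded by a constant times [eps^n / n!] for every positive [eps]: the function is entire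
    and grows more slowly than [exp (eps |z|)] for every [eps] ([minimal_type]). The theorem is
    the case of this function, which has no zero coefficient, of a general fact: an entire
    function of minimal exponential type with finitely many zeros is a polynomial
    ([finitely_many_zeros_polynomial]).

    The usual proof divides by a polynomial to remove the zeros, writes the quotient as [exp g],
    and uses growth to show that [g] is constant. Here the same idea is carried out without
    contour integrals, factorization theorems or logarithms of analytic functions.

    - Zeros are removed on the level of coefficients. The quotient of [psum a z - psum a w] by
      [z - w] has explicit coefficients [divided w a], again of minimal type
      ([psum_divided]), and a zero of infinite order forces the function to vanish
      identically, because the iterated quotients have coefficient bounds that improve
      geometrically ([infinite_order_zero]).

    - For a function [h] without zeros, the logarithmic derivative [h' / h] is bounded on a disc
      of radius [r] in terms of an upper bound of [ln |h|] and of its value at the point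
      considered, without any lower bound on the disc ([log_derivative_bound]). This is the
      Schwarz-Pick inequality for [log h], proved by Ahlfors' method: at an interior maximum of [|h' / h| (r^2 - |z|^2) / (M - ln |h|^2)] the Laplacian of its logarithm is
      nonpositive, and the harmonic terms drop out.

    - Minimal type makes this bound tend to [0] as [r] tends to infinity, so that [h' = 0]
      ([zero_free_derivative]), and the identity theorem ([psum_zero_coef]) shows that all
      coefficients but the first vanish. *)

(** * Dominated complex series *)

Local Notation is_Cseries := (@is_series C_AbsRing C_NormedModule).

Lemma is_series_Re (u : nat -> C) (l : C) :
  is_Cseries u l -> is_series (fun n => Re (u n)) (Re l).
Proof.
  intros H.
  apply filterlim_ext with (f := fun n => fst (@sum_n C_NormedModule u n)).
  - induction x as [|n IH].
    + now rewrite !sum_O.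
    + rewrite !sum_Sn. now rewrite <- IH.
  - apply (filterlim_comp _ _ _ _ _ _ _ _ H).
    destruct l as [p q]. exact (@continuous_fst R_UniformSpace R_UniformSpace p q).
Qed.

Lemma is_series_Im (u : nat -> C) (l : C) :
  is_Cseries u l -> is_series (fun n => Im (u n)) (Im l).
Proof.
  intros H.
  apply filterlim_ext with (f := fun n => snd (@sum_n C_NormedModule u n)).
  - induction x as [|n IH].
    + now rewrite !sum_O.
    + rewrite !sum_Sn. now rewrite <- IH.
  - apply (filterlim_comp _ _ _ _ _ _ _ _ H).
    destruct l as [p q]. exact (@continuous_snd R_UniformSpace R_UniformSpace p q).
Qed.

Lemma CSeries_unique (u : nat -> C) (l : C) : is_Cseries u l -> CSeries u = l.
Proof.
  intros H. unfold CSeries.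
  rewrite (is_series_unique _ _ (is_series_Re _ _ H)).
  rewrite (is_series_unique _ _ (is_series_Im _ _ H)).
  now destruct l.
Qed.

Lemma CSeries_ext (u v : nat -> C) : (forall n, u n = v n) -> CSeries u = CSeries v.
Proof.
  intros H. unfold CSeries. f_equal; apply Series_ext; intros n; now rewrite H.
Qed.

(** Partial sums satisfy the bound by the triangle inequality, and it passes
    to the limit. *)
Lemma is_Cseries_le (u : nat -> C) (v : nat -> R) (l : C) (L : R) :
  (forall n, Cmod (u n) <= v n) -> is_Cseries u l -> is_series v L -> Cmod l <= L.
Proof.
  intros Huv Hu Hv.
  apply (is_lim_seq_le (fun n => Cmod (@sum_n C_NormedModule u n)) (sum_n v) (Cmod l) L).
  - intros n.
    eapply Rle_trans. apply (@norm_sum_n_m C_AbsRing C_NormedModule).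
    apply sum_n_m_le. exact Huv.
  - unfold is_lim_seq.
    refine (filterlim_comp _ _ _ (@sum_n C_NormedModule u) Cmod _ _ _ Hu _).
    exact (@filterlim_norm C_AbsRing C_NormedModule l).
  - exact Hv.
Qed.

Lemma CSeries_dominated (u : nat -> C) (v : nat -> R) (L : R) :
  (forall n, Cmod (u n) <= v n) -> is_series v L ->
  is_Cseries u (CSeries u) /\ Cmod (CSeries u) <= L.
Proof.
  intros Huv Hv.
  destruct (@ex_series_le C_AbsRing C_CompleteNormedModule u v Huv (ex_intro _ L Hv)) as [l Hl].
  rewrite (CSeries_unique _ _ Hl). split; [exact Hl|].
  exact (is_Cseries_le u v l L Huv Hl Hv).
Qed.

(** * Power series of minimal exponential type *)

Lemma is_series_exp (x : R) : is_series (fun n => x ^ n / INR (fact n)) (exp x).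
Proof.
  apply is_series_ext with (2 := is_exp_Reals x).
  intros n. rewrite pow_n_pow. reflexivity.
Qed.

Lemma pow_div_fact_ge0 (x : R) (n : nat) : 0 <= x -> 0 <= x ^ n / INR (fact n).
Proof.
  intros Hx. apply Rdiv_le_0_compat; [now apply pow_le | apply INR_fact_lt_0].
Qed.

(** The coefficients of the comparison function [K * exp (eps * z)]. Both constants
    are tracked because dividing by a linear factor changes only [K], by a factor
    that can be iterated. *)
Definition exp_bounded (K eps : R) (a : nat -> C) : Prop :=
  forall n, Cmod (a n) <= K * (eps ^ n / INR (fact n)).

(** Coefficientwise form of growth [O(exp (eps |z|))] for every positive [eps]. Stated on
    coefficients, it is visibly stable under differentiation and under division
    by [z - w], and no Cauchy estimate is ever needed to go back from growth to
    coefficients. *)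
Definition minimal_type (a : nat -> C) : Prop :=
  forall eps, 0 < eps -> exists K, exp_bounded K eps a.

Definition psum (a : nat -> C) (z : C) : C := CSeries (fun n => (a n * z ^ n)%C).

Lemma exp_bounded_ge0 K eps a : exp_bounded K eps a -> 0 <= K.
Proof.
  intros H. generalize (H 0%nat) (Cmod_ge_0 (a 0%nat)). simpl. lra.
Qed.

Lemma exp_bounded_term K eps a z n : exp_bounded K eps a ->
  Cmod (a n * z ^ n) <= K * ((eps * Cmod z) ^ n / INR (fact n)).
Proof.
  intros H. rewrite Cmod_mult, Cmod_pow, Rpow_mult_distr.
  replace (K * (eps ^ n * Cmod z ^ n / INR (fact n)))
    with (K * (eps ^ n / INR (fact n)) * Cmod z ^ n) by (unfold Rdiv; ring).
  apply Rmult_le_compat_r; [apply pow_le, Cmod_ge_0 | apply H].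
Qed.

Lemma psum_exp_bounded K eps a z : exp_bounded K eps a ->
  is_Cseries (fun n => (a n * z ^ n)%C) (psum a z)
  /\ Cmod (psum a z) <= K * exp (eps * Cmod z).
Proof.
  intros H.
  apply (CSeries_dominated _ (fun n => K * ((eps * Cmod z) ^ n / INR (fact n)))).
  - intros n. now apply exp_bounded_term.
  - apply (@is_series_scal R_AbsRing), is_series_exp.
Qed.

Lemma psum_is_series a z : minimal_type a ->
  is_Cseries (fun n => (a n * z ^ n)%C) (psum a z).
Proof.
  intros H. destruct (H 1 Rlt_0_1) as [K HK]. exact (proj1 (psum_exp_bounded K 1 a z HK)).
Qed.

(** * Dividing by a linear factor *)

(** Coefficients of the quotient [(psum a z - psum a w) / (z - w)], obtained by
    expanding [(z ^ n - w ^ n) / (z - w)] and collecting powers of [z]. *)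
Definition divided (w : C) (a : nat -> C) (n : nat) : C :=
  psum (fun j => a (S (n + j))) w.

(** It lets the two factors of the double sum in [divided] decay independently. *)
Lemma fact_mult_le (n j : nat) : INR (fact n) * INR (fact j) <= INR (fact (n + j)).
Proof.
  rewrite <- mult_INR. apply le_INR.
  induction j as [|j IH]; [rewrite Nat.add_0_r; simpl; lia|].
  rewrite Nat.add_succ_r. simpl. nia.
Qed.

Lemma exp_bounded_tail K eps a n : 0 <= eps -> exp_bounded K eps a ->
  exp_bounded (K * eps * (eps ^ n / INR (fact n))) eps (fun j => a (S (n + j))).
Proof.
  intros He H j. eapply Rle_trans. apply H.
  replace (eps ^ S (n + j)) with (eps * (eps ^ n * eps ^ j)) by (simpl; rewrite pow_add; ring).
  assert (HK := exp_bounded_ge0 _ _ _ H).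
  replace (K * eps * (eps ^ n / INR (fact n)) * (eps ^ j / INR (fact j)))
    with (K * (eps * (eps ^ n * eps ^ j) / (INR (fact n) * INR (fact j))))
    by (field; split; apply INR_fact_neq_0).
  apply Rmult_le_compat_l; [exact HK|].
  apply Rmult_le_compat_l.
  { repeat apply Rmult_le_pos; auto using pow_le. }
  apply Rinv_le_contravar.
  { apply Rmult_lt_0_compat; apply INR_fact_lt_0. }
  eapply Rle_trans; [apply fact_mult_le|].
  apply le_INR, fact_le. lia.
Qed.

(** The factor [eps * exp (eps * Cmod w)] tends to [0] with [eps]; this is what
    makes [infinite_order_zero] work. *)
Lemma divided_exp_bounded K eps a w : 0 <= eps -> exp_bounded K eps a ->
  exp_bounded (K * (eps * exp (eps * Cmod w))) eps (divided w a).
Proof.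
  intros He H n.
  replace (K * (eps * exp (eps * Cmod w)) * (eps ^ n / INR (fact n)))
    with (K * eps * (eps ^ n / INR (fact n)) * exp (eps * Cmod w)) by ring.
  apply psum_exp_bounded. now apply exp_bounded_tail.
Qed.

Lemma divided_minimal_type a w : minimal_type a -> minimal_type (divided w a).
Proof.
  intros H eps He. destruct (H eps He) as [K HK].
  eexists. apply divided_exp_bounded; [lra | exact HK].
Qed.

Lemma tail_minimal_type a n : minimal_type a -> minimal_type (fun j => a (S (n + j))).
Proof.
  intros H eps He. destruct (H eps He) as [K HK].
  eexists. apply exp_bounded_tail; [lra | exact HK].
Qed.

Lemma shift_minimal_type a : minimal_type a -> minimal_type (fun j => a (S j)).
Proof. exact (tail_minimal_type a 0). Qed.

Lemma psum_shift a z : minimal_type a ->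
  psum a z = (a 0%nat + z * psum (fun n => a (S n)) z)%C.
Proof.
  intros H. apply CSeries_unique.
  assert (E : is_Cseries (fun n => (z * (a (S n) * z ^ n))%C)
                (z * psum (fun n => a (S n)) z)%C).
  { exact (is_series_scal z _ _ (psum_is_series _ z (shift_minimal_type a H))). }
  apply is_series_decr_1.
  match goal with |- is_series _ ?l =>
    replace l with (z * psum (fun n => a (S n)) z)%C end.
  - refine (is_series_ext _ _ _ _ E). intros n. simpl. ring.
  - change (z * psum (fun n => a (S n)) z =
        (a 0%nat + z * psum (fun n : nat => a (S n)) z) + - (a 0%nat * z ^ 0))%C.
    simpl. ring.
Qed.

(** Synthetic division: comparing coefficients in
    [(z - w) * psum (divided w a) z = psum a z - psum a w]. *)
Lemma divided_rec a w n : minimal_type a ->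
  divided w a n = (a (S n) + w * divided w a (S n))%C.
Proof.
  intros H. unfold divided. rewrite (psum_shift _ _ (tail_minimal_type a n H)).
  rewrite Nat.add_0_r. do 2 f_equal.
  apply CSeries_ext. intros j. now rewrite Nat.add_succ_r.
Qed.

Lemma psum_lin (a b : nat -> C) (c z : C) : minimal_type a -> minimal_type b ->
  psum (fun n => (a n + c * b n)%C) z = (psum a z + c * psum b z)%C.
Proof.
  intros Ha Hb. apply CSeries_unique.
  assert (E := is_series_plus _ _ _ _ (psum_is_series _ z Ha)
     (is_series_scal c _ _ (psum_is_series _ z Hb))).
  refine (is_series_ext _ _ _ _ E).
  intros n. change (a n * z ^ n + c * (b n * z ^ n) = (a n + c * b n) * z ^ n)%C. ring.
Qed.

Lemma psum_divided a w z : minimal_type a ->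
  (psum a z = psum a w + (z - w) * psum (divided w a) z)%C.
Proof.
  intros H.
  assert (Hd := divided_minimal_type a w H).
  assert (E : (psum (divided w a) z
      = psum (fun n => a (S n)) z + w * psum (fun n => divided w a (S n)) z)%C).
  { rewrite <- psum_lin; [| now apply shift_minimal_type..].
    apply CSeries_ext. intros n. now rewrite <- divided_rec. }
  rewrite (psum_shift a z H), (psum_shift a w H).
  change (psum (fun n => a (S n)) w) with (divided w a 0).
  replace ((z - w) * psum (divided w a) z)%C
    with (z * psum (divided w a) z - w * psum (divided w a) z)%C by ring.
  rewrite E at 1. rewrite (psum_shift _ z Hd). ring.
Qed.

Fixpoint divided_iter (w : C) (m : nat) (a : nat -> C) : nat -> C :=
  match m with O => a | S m => divided w (divided_iter w m a) end.

Lemma divided_iter_exp_bounded K eps a w m : 0 <= eps -> exp_bounded K eps a ->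
  exp_bounded (K * (eps * exp (eps * Cmod w)) ^ m) eps (divided_iter w m a).
Proof.
  intros He H. induction m as [|m IH]; simpl.
  - now rewrite Rmult_1_r.
  - replace (K * (eps * exp (eps * Cmod w) * (eps * exp (eps * Cmod w)) ^ m))
      with (K * (eps * exp (eps * Cmod w)) ^ m * (eps * exp (eps * Cmod w))) by ring.
    now apply divided_exp_bounded.
Qed.

Lemma divided_iter_minimal_type a w m : minimal_type a -> minimal_type (divided_iter w m a).
Proof.
  intros H. induction m as [|m IH]; simpl; auto using divided_minimal_type.
Qed.

Lemma psum_divided_iter a w z m : minimal_type a ->
  (forall k, (k < m)%nat -> psum (divided_iter w k a) w = 0) ->
  (psum a z = (z - w) ^ m * psum (divided_iter w m a) z)%C.
Proof.
  intros H Hz. induction m as [|m IH].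
  - simpl. ring.
  - rewrite IH by (intros; apply Hz; lia).
    rewrite (psum_divided _ w z) by now apply divided_iter_minimal_type.
    rewrite Hz by lia. simpl. ring.
Qed.

(** If [psum a] is divisible by every power of [z - w], then for all [m] it is
    bounded at [z] by [C * (|z - w| * eps * exp (eps * |w|)) ^ m], and [eps] can be
    chosen, depending on [z], so that the base is at most [1 / 2]. *)
Lemma infinite_order_zero a w : minimal_type a ->
  (forall m, psum (divided_iter w m a) w = 0) -> forall z, psum a z = 0.
Proof.
  intros H Hz z.
  (* as [eps <= 1], the base is at most [eps * c], and [eps * c = 1 / 2] *)
  set (c := (Cmod (z - w) + 1) * exp (Cmod w)).
  assert (Hc1 : 1 <= c).
  { unfold c. assert (1 <= exp (Cmod w)).
    { rewrite <- exp_0. generalize (Cmod_ge_0 w). intros [X|<-]; [left; now apply exp_increasing|lra]. }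
    generalize (Cmod_ge_0 (z - w)). nra. }
  set (eps := / (2 * c)).
  assert (Heps : 0 < eps) by (apply Rinv_0_lt_compat; lra).
  assert (Heps1 : eps <= 1).
  { unfold eps. rewrite <- Rinv_1. apply Rinv_le_contravar; lra. }
  destruct (H eps Heps) as [K HK].
  assert (HKp := exp_bounded_ge0 _ _ _ HK).
  assert (Hq : Cmod (z - w) * (eps * exp (eps * Cmod w)) <= / 2).
  { apply Rle_trans with (eps * c).
    - unfold c. replace (Cmod (z - w) * (eps * exp (eps * Cmod w)))
        with (eps * (Cmod (z - w) * exp (eps * Cmod w))) by ring.
      apply Rmult_le_compat_l; [lra|].
      apply Rmult_le_compat; try apply Cmod_ge_0; try lra.
      + left; apply exp_pos.
      + assert (X : eps * Cmod w <= Cmod w) by (generalize (Cmod_ge_0 w); nra).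
        destruct X as [X|X]; [left; now apply exp_increasing | rewrite X; lra].
    - unfold eps. right. field. lra. }
  assert (Hb : forall m, Cmod (psum a z) <= (K * exp (eps * Cmod z)) * (/ 2) ^ m).
  { intros m. rewrite (psum_divided_iter a w z m) by auto.
    rewrite Cmod_mult, Cmod_pow.
    assert (B := proj2 (psum_exp_bounded _ _ _ z
       (divided_iter_exp_bounded K eps a w m (Rlt_le _ _ Heps) HK))).
    eapply Rle_trans.
    { apply Rmult_le_compat_l; [apply pow_le, Cmod_ge_0 | exact B]. }
    replace (Cmod (z - w) ^ m * (K * (eps * exp (eps * Cmod w)) ^ m * exp (eps * Cmod z)))
      with (K * exp (eps * Cmod z) * (Cmod (z - w) * (eps * exp (eps * Cmod w))) ^ m)
      by (rewrite (Rpow_mult_distr (Cmod (z - w))); ring).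
    apply Rmult_le_compat_l.
    { apply Rmult_le_pos; [exact HKp | left; apply exp_pos]. }
    apply pow_incr. split; [|exact Hq].
    apply Rmult_le_pos; [apply Cmod_ge_0|].
    apply Rmult_le_pos; [lra | left; apply exp_pos]. }
  apply Cmod_eq_0, Rle_antisym; [|apply Cmod_ge_0].
  apply (is_lim_seq_le _ _ (Finite (Cmod (psum a z))) (Finite 0) Hb).
  - apply is_lim_seq_const.
  - replace 0 with (K * exp (eps * Cmod z) * 0) by ring.
    apply (is_lim_seq_scal_l _ _ (Finite 0)), is_lim_seq_geom.
    rewrite Rabs_pos_eq; lra.
Qed.

(** * Differentiating power series *)

(** Complex differentiability with a quadratic remainder. Power series satisfy it,
    and it restricts to real lines with the same bound, so that real and imaginary
    parts can be differentiated along a direction without a chain rule between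
    normed modules. *)
Definition has_deriv (g : C -> C) (z l : C) : Prop :=
  exists B, 0 <= B /\ forall k, Cmod k <= 1 ->
    Cmod (g (z + k)%C - g z - k * l) <= B * Cmod k ^ 2.

Definition derived (a : nat -> C) (n : nat) : C := (INR (S n) * a (S n))%C.

Lemma derived_eq_0 a n : derived a n = 0 -> a (S n) = 0.
Proof.
  unfold derived. intros E.
  destruct (Ceq_dec (a (S n)) 0) as [|Ha]; [assumption|].
  exfalso. revert E. apply Cmult_neq_0; [|exact Ha].
  intros E. apply RtoC_inj in E. revert E. now apply not_0_INR.
Qed.

Lemma derived_minimal_type a : minimal_type a -> minimal_type (derived a).
Proof.
  intros H eps He. destruct (H eps He) as [K HK]. exists (K * eps). intros n.
  unfold derived. rewrite Cmod_mult, Cmod_R, (Rabs_pos_eq _ (pos_INR _)).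
  apply Rle_trans with (INR (S n) * (K * (eps ^ S n / INR (fact (S n))))).
  - apply Rmult_le_compat_l; [apply pos_INR | apply HK].
  - right. rewrite fact_simpl, mult_INR. simpl pow. field.
    split; [apply INR_fact_neq_0 | now apply not_0_INR].
Qed.

(** The remainders satisfy
    [E (n + 1) = (z + k) * E n + n * k ^ 2 * z ^ (n - 1)]; the crude factor
    [2 ^ n] absorbs [n] and is harmless against [1 / n!]. *)
Lemma pow_taylor2 (z k : C) (r : R) (n : nat) : 1 <= r -> Cmod z <= r -> Cmod (z + k) <= r ->
  Cmod ((z + k) ^ n - z ^ n - k * (INR n * z ^ pred n)) <= Cmod k ^ 2 * (2 * r) ^ n.
Proof.
  intros Hr Hz Hzk.
  induction n as [|n IH].
  - replace ((z + k) ^ 0 - z ^ 0 - k * (INR 0 * z ^ pred 0))%C with (RtoC 0) by (simpl; ring).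
    rewrite Cmod_0. generalize (pow2_ge_0 (Cmod k)). simpl. lra.
  - replace ((z + k) ^ S n - z ^ S n - k * (INR (S n) * z ^ pred (S n)))%C
      with ((z + k) * ((z + k) ^ n - z ^ n - k * (INR n * z ^ pred n))
            + INR n * k ^ 2 * z ^ pred n)%C.
    2:{ rewrite S_INR, RtoC_plus. destruct n; simpl pred; simpl Cpow; simpl INR; ring. }
    eapply Rle_trans; [apply Cmod_triangle|].
    rewrite !Cmod_mult, !Cmod_pow, Cmod_R, (Rabs_pos_eq _ (pos_INR _)).
    assert (H1 : Cmod z ^ pred n <= r ^ n).
    { apply Rle_trans with (r ^ pred n).
      - apply pow_incr. split; [apply Cmod_ge_0 | exact Hz].
      - apply Rle_pow; [exact Hr | lia]. }
    assert (H2 : INR n <= 2 ^ n).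
    { clear. induction n as [|n IH]; [simpl; lra|].
      rewrite S_INR. simpl. assert (1 <= 2 ^ n) by (apply pow_R1_Rle; lra). lra. }
    assert (Hk := pow2_ge_0 (Cmod k)).
    assert (H3 : 0 <= (2 * r) ^ n) by (apply pow_le; lra).
    apply Rle_trans with (r * (Cmod k ^ 2 * (2 * r) ^ n) + Cmod k ^ 2 * (2 ^ n * r ^ n)).
    + apply Rplus_le_compat.
      * apply Rmult_le_compat; auto using Cmod_ge_0.
      * replace (INR n * Cmod k ^ 2 * Cmod z ^ pred n)
          with (Cmod k ^ 2 * (INR n * Cmod z ^ pred n)) by ring.
        apply Rmult_le_compat_l; [exact Hk|].
        apply Rmult_le_compat; auto using pos_INR, pow_le, Cmod_ge_0.
    + rewrite <- Rpow_mult_distr. simpl (_ ^ S n).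
      replace (r * (Cmod k ^ 2 * (2 * r) ^ n) + Cmod k ^ 2 * (2 * r) ^ n)
        with (Cmod k ^ 2 * (2 * r) ^ n * (r + 1)) by ring.
      replace (Cmod k ^ 2 * (2 * r * (2 * r) ^ n))
        with (Cmod k ^ 2 * (2 * r) ^ n * (2 * r)) by ring.
      apply Rmult_le_compat_l; [now apply Rmult_le_pos | lra].
Qed.

(** The derived series with its vanishing term at [0] kept, so that it can be combined
    termwise with the series of [psum a]. *)
Lemma psum_derived_series a z : minimal_type a ->
  is_Cseries (fun n => (a n * (INR n * z ^ pred n))%C) (psum (derived a) z).
Proof.
  intros H. apply is_series_decr_1.
  match goal with |- is_series _ ?l => replace l with (psum (derived a) z) end.
  - refine (is_series_ext _ _ _ _ (psum_is_series _ z (derived_minimal_type a H))).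
    intros n. unfold derived. simpl pred.
    change (INR (S n) * a (S n) * z ^ n = a (S n) * (INR (S n) * z ^ n))%C. ring.
  - change (psum (derived a) z = psum (derived a) z + - (a 0%nat * (INR 0 * z ^ pred 0)))%C.
    simpl. ring.
Qed.

Lemma psum_has_deriv a z : minimal_type a -> has_deriv (psum a) z (psum (derived a) z).
Proof.
  intros H. destruct (H 1 Rlt_0_1) as [K HK].
  exists (K * exp (2 * (Cmod z + 1))). split.
  { apply Rmult_le_pos; [exact (exp_bounded_ge0 _ _ _ HK) | left; apply exp_pos]. }
  intros k Hk.
  assert (E := is_series_plus _ _ _ _
    (is_series_plus _ _ _ _ (psum_is_series a (z + k) H)
       (is_series_scal (RtoC (-1)) _ _ (psum_is_series a z H)))
    (is_series_scal (- k)%C _ _ (psum_derived_series a z H))).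
  assert (S : is_series (fun n => K * (Cmod k ^ 2) * ((2 * (Cmod z + 1)) ^ n / INR (fact n)))
     (K * Cmod k ^ 2 * exp (2 * (Cmod z + 1)))).
  { apply (@is_series_scal R_AbsRing), is_series_exp. }
  assert (T := fun A => is_Cseries_le _ _ _ _ A E S).
  eapply Rle_trans; [|eapply Rle_trans; [apply T|]]; [right; apply f_equal| |right].
  - change (psum a (z + k) - psum a z - k * psum (derived a) z =
       psum a (z + k) + RtoC (-1) * psum a z + (- k) * psum (derived a) z)%C.
    replace (RtoC (-1)) with (- (1))%C by (now rewrite <- RtoC_opp). ring.
  - intros n.
    match goal with |- Cmod ?u <= _ =>
      replace u with (a n * ((z + k) ^ n - z ^ n - k * (INR n * z ^ pred n)))%C end.
    2:{ change (a n * ((z + k) ^ n - z ^ n - k * (INR n * z ^ pred n))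
         = a n * (z + k) ^ n + RtoC (-1) * (a n * z ^ n) + (- k) * (a n * (INR n * z ^ pred n)))%C.
        replace (RtoC (-1)) with (- (1))%C by (now rewrite <- RtoC_opp). ring. }
    rewrite Cmod_mult.
    replace (K * Cmod k ^ 2 * ((2 * (Cmod z + 1)) ^ n / INR (fact n)))
      with ((K * (1 ^ n / INR (fact n))) * (Cmod k ^ 2 * (2 * (Cmod z + 1)) ^ n))
      by (rewrite pow1; unfold Rdiv; ring).
    apply Rmult_le_compat; try apply Cmod_ge_0; [apply HK|].
    apply pow_taylor2; generalize (Cmod_ge_0 z) (Cmod_triangle z k); lra.
  - ring.
Qed.

Lemma has_deriv_is_derive g z l :
  has_deriv g z l -> @is_derive C_AbsRing C_NormedModule g z l.
Proof.
  intros [B [HB H]]. split.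
  { apply is_linear_scal_l. }
  intros x Hx. apply (is_filter_lim_locally_unique (V := AbsRing_NormedModule C_AbsRing)) in Hx.
  subst x. intros eps.
  assert (Hd : 0 < Rmin 1 (eps / (B + 1))).
  { apply Rmin_pos; [lra|]. apply Rdiv_lt_0_compat; [apply cond_pos | lra]. }
  exists (mkposreal _ Hd). intros y Hy.
  change (Cmod (y - z) < Rmin 1 (eps / (B + 1))) in Hy.
  change (Cmod (g y - g z - (y - z) * l) <= eps * Cmod (y - z)).
  assert (H1 := Rmin_l 1 (eps / (B + 1))). assert (H2 := Rmin_r 1 (eps / (B + 1))).
  assert (G := H (y - z)%C ltac:(lra)).
  assert (E : @eq C (z + (y - z))%C y) by ring. rewrite E in G.
  eapply Rle_trans; [exact G|].
  simpl pow. rewrite Rmult_1_r, <- Rmult_assoc.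
  apply Rmult_le_compat_r; [apply Cmod_ge_0|].
  assert (H0 := Cmod_ge_0 (y - z)).
  apply Rle_trans with ((B + 1) * (eps / (B + 1))).
  - apply Rmult_le_compat; lra.
  - right. field. lra.
Qed.

Lemma has_deriv_zero_fun (g : C -> C) (z l : C) : (forall y, g y = 0) -> has_deriv g z l -> l = 0.
Proof.
  intros Hg [B [HB H]].
  apply Cmod_eq_0. apply Rle_antisym; [|apply Cmod_ge_0].
  apply le_epsilon. intros eps He.
  set (t := Rmin 1 (eps / (B + 1))).
  assert (Ht : 0 < t).
  { apply Rmin_pos; [lra|]. apply Rdiv_lt_0_compat; lra. }
  assert (H1 : t <= 1) by apply Rmin_l.
  assert (H2 : t <= eps / (B + 1)) by apply Rmin_r.
  assert (Mt : Cmod t = t) by (rewrite Cmod_R; apply Rabs_pos_eq; lra).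
  assert (G := H (RtoC t) ltac:(lra)).
  rewrite !Hg in G.
  replace (0 - 0 - t * l)%C with (- (t * l))%C in G by ring.
  rewrite Cmod_opp, Cmod_mult, Mt in G.
  assert (G' : Cmod l <= B * t).
  { apply Rmult_le_reg_l with t; [exact Ht|]. lra. }
  assert (B * t <= eps).
  { apply Rle_trans with ((B + 1) * (eps / (B + 1))).
    - apply Rmult_le_compat; lra.
    - right. field. lra. }
  lra.
Qed.

Lemma psum_at_0 a : minimal_type a -> psum a 0 = a 0%nat.
Proof. intros H. rewrite (psum_shift a 0 H). ring. Qed.

(** Identity theorem: all derivatives of the zero function vanish, and their values
    at [0] are the coefficients up to factorials. *)
Lemma psum_zero_coef a : minimal_type a -> (forall z, psum a z = 0) -> forall n, a n = 0.
Proof.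
  intros H Hz n. revert a H Hz. induction n as [|n IH]; intros a H Hz.
  - now rewrite <- psum_at_0.
  - assert (E : derived a n = 0).
    { apply IH; [now apply derived_minimal_type|].
      intros z. exact (has_deriv_zero_fun (psum a) z _ Hz (psum_has_deriv a z H)). }
    now apply derived_eq_0.
Qed.

(** * Maxima of real functions *)

(** Extreme value theorem on a square, for functions of a complex variable. If the
    supremum [s] were not attained, each point would have a neighbourhood on which
    the function stays below [s] by at least the radius of that neighbourhood;
    compactness makes the radii bounded below, so that [s] would not be the least
    upper bound. *)
Lemma continuous_max_square (f : C -> R) (r : R) : 0 <= r ->
  (forall z : C, Rabs (Re z) <= r -> Rabs (Im z) <= r ->
     @continuous C_UniformSpace R_UniformSpace f z) ->
  exists m : C, (Rabs (Re m) <= r /\ Rabs (Im m) <= r) /\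
    forall z : C, Rabs (Re z) <= r -> Rabs (Im z) <= r -> f z <= f m.
Proof.
  intros Hr Hf.
  (* composing with [atan] keeps the maximisers and gives boundedness for free *)
  set (g := fun z => atan (f z)).
  assert (Hg : forall z : C, Rabs (Re z) <= r -> Rabs (Im z) <= r ->
     @continuous C_UniformSpace R_UniformSpace g z).
  { intros z Hx Hy. apply (continuous_comp f atan).
    - now apply Hf.
    - apply continuity_pt_filterlim, derivable_continuous_pt, derivable_pt_atan. }
  set (P := fun y => exists z : C, (Rabs (Re z) <= r /\ Rabs (Im z) <= r) /\ y = g z).
  destruct (completeness P) as [s [Hs1 Hs2]].
  { exists (PI / 2). intros y [z [_ ->]]. left. apply atan_bound. }
  { exists (g 0), 0%C. simpl. rewrite Rabs_R0. auto. }
  destruct (classic (exists m : C, (Rabs (Re m) <= r /\ Rabs (Im m) <= r) /\ g m = s))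
    as [[m [Hm Em]]|N].
  { exists m. split; [exact Hm|]. intros z Hx Hy.
    destruct (Rle_or_lt (f z) (f m)) as [|L]; [assumption|].
    apply atan_increasing in L. fold (g m) (g z) in L. rewrite Em in L.
    assert (g z <= s) by (apply Hs1; exists z; auto). lra. }
  exfalso.
  assert (D : forall u v : R, exists d : posreal,
    (Rabs u <= r /\ Rabs v <= r) -> d <= (s - g (u, v)) / 2 /\
      forall x y, Rabs (x - u) < d -> Rabs (y - v) < d ->
        g (x, y) <= g (u, v) + (s - g (u, v)) / 2).
  { intros u v.
    destruct (classic (Rabs u <= r /\ Rabs v <= r)) as [Hin|Hin];
      [|now exists (mkposreal 1 Rlt_0_1)].
    destruct (Rlt_or_le (g (u, v)) s) as [L|L].
    - assert (He : 0 < (s - g (u, v)) / 2) by lra.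
      destruct (proj1 (filterlim_locally _ _) (Hg (u, v) (proj1 Hin) (proj2 Hin)) (mkposreal _ He)) as [d Hd].
      assert (Hm : 0 < Rmin d ((s - g (u, v)) / 2)) by (apply Rmin_pos; [apply cond_pos | lra]).
      exists (mkposreal _ Hm). intros _. simpl. split; [apply Rmin_r|].
      intros x y Hx Hy.
      assert (B := Hd (x, y)).
      assert (L2 := Rmin_l d ((s - g (u, v)) / 2)).
      assert (B' : Rabs (g (x, y) - g (u, v)) < (s - g (u, v)) / 2).
      { apply B. split; simpl; [change (Rabs (x - u) < d) | change (Rabs (y - v) < d)]; lra. }
      apply Rabs_def2 in B'. lra.
    - exists (mkposreal 1 Rlt_0_1). intros _. exfalso. apply N. exists (u, v).
      split; [exact Hin|]. apply Rle_antisym; [|exact L]. apply Hs1. now exists (u, v). }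
  set (delta := fun u v => proj1_sig (constructive_indefinite_description _ (D u v))).
  destruct (compactness_value_2d (- r) r (- r) r delta) as [d Hd].
  assert (U : s <= s - d).
  { apply Hs2. intros y [z [[Hx Hy] ->]].
    apply Rabs_le_between in Hx. apply Rabs_le_between in Hy.
    apply NNPP. intros Nz. apply (Hd (Re z) (Im z) Hx Hy).
    intros [u [v [Hu [Hv [Hxu [Hyv Hdd]]]]]]. apply Nz.
    apply Rabs_le_between in Hu. apply Rabs_le_between in Hv.
    destruct (proj2_sig (constructive_indefinite_description _ (D u v)) (conj Hu Hv)) as [E1 E2].
    fold (delta u v) in E1, E2.
    assert (E3 := E2 (Re z) (Im z) Hxu Hyv).
    replace (Re z, Im z) with z in E3 by (now destruct z). lra. }
  generalize (cond_pos d). lra.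
Qed.

(** * Directional derivatives *)

Lemma im_le_Cmod (z : C) : Rabs (Im z) <= Cmod z.
Proof. eapply Rle_trans; [|apply Rmax_Cmod]. apply Rmax_r. Qed.

Lemma is_derive_R_quadratic (f : R -> R) (x l B : R) : 0 <= B ->
  (forall s, Rabs s <= 1 -> Rabs (f (x + s) - f x - s * l) <= B * s ^ 2) ->
  is_derive f x l.
Proof.
  intros HB H. apply is_derive_Reals. intros eps He.
  assert (Hd : 0 < Rmin 1 (eps / (B + 1))).
  { apply Rmin_pos; [lra|]. apply Rdiv_lt_0_compat; lra. }
  exists (mkposreal _ Hd). intros s Hs Hs'. simpl in Hs'.
  assert (H1 := Rmin_l 1 (eps / (B + 1))). assert (H2 := Rmin_r 1 (eps / (B + 1))).
  assert (G := H s ltac:(lra)).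
  assert (Hp : 0 < Rabs s) by now apply Rabs_pos_lt.
  replace ((f (x + s) - f x) / s - l) with ((f (x + s) - f x - s * l) / s) by (now field).
  unfold Rdiv. rewrite Rabs_mult, Rabs_inv.
  apply Rle_lt_trans with (B * Rabs s).
  - apply Rmult_le_reg_r with (Rabs s); [exact Hp|].
    rewrite Rmult_assoc, Rinv_l, Rmult_1_r by lra.
    rewrite <- (pow2_abs s) in G. simpl in G. lra.
  - apply Rle_lt_trans with (B * (eps / (B + 1))).
    + apply Rmult_le_compat_l; lra.
    + apply Rlt_le_trans with ((B + 1) * (eps / (B + 1))).
      * apply Rmult_lt_compat_r; [apply Rdiv_lt_0_compat|]; lra.
      * right. field. lra.
Qed.

Definition line (z d : C) (t : R) : C := (z + t * d)%C.

Lemma has_deriv_line (g : C -> C) (z d l : C) (t : R) : Cmod d = 1 ->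
  has_deriv g (line z d t) l ->
  is_derive (fun s => Re (g (line z d s))) t (Re (d * l)) /\
  is_derive (fun s => Im (g (line z d s))) t (Im (d * l)).
Proof.
  intros Hd [B [HB H]].
  assert (E : forall s, Rabs s <= 1 ->
    Cmod (g (line z d (t + s)) - g (line z d t) - s * (d * l)) <= B * s ^ 2).
  { intros s Hs.
    assert (M : Cmod (s * d) = Rabs s) by (rewrite Cmod_mult, Cmod_R, Hd; ring).
    assert (G := H (s * d)%C ltac:(lra)). rewrite M, pow2_abs in G.
    replace (line z d (t + s)) with (line z d t + s * d)%C
      by (unfold line; rewrite RtoC_plus; ring).
    now rewrite Cmult_assoc. }
  split; apply is_derive_R_quadratic with B; try exact HB; intros s Hs;
    (eapply Rle_trans; [|apply (E s Hs)]); [eapply Rle_trans; [|apply re_le_Cmod] | eapply Rle_trans; [|apply im_le_Cmod]];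
    right; apply f_equal; unfold Re, Im; simpl; ring.
Qed.

Lemma continuous_Cmod_has_deriv (g g' : C -> C) : (forall z, has_deriv g z (g' z)) ->
  forall z, @continuous C_UniformSpace R_UniformSpace (fun y => Cmod (g y)) z.
Proof.
  intros H z. destruct (H z) as [B [HB Hz]].
  apply filterlim_locally. intros eps.
  set (c := B + Cmod (g' z) + 1).
  assert (Hc : 1 <= c) by (unfold c; generalize (Cmod_ge_0 (g' z)); lra).
  assert (Hd : 0 < Rmin (1 / 2) (eps / (4 * c))).
  { apply Rmin_pos; [lra|]. apply Rdiv_lt_0_compat; [apply cond_pos | lra]. }
  exists (mkposreal _ Hd). intros y [Hx Hy].
  change (Rabs (Re y - Re z) < Rmin (1 / 2) (eps / (4 * c))) in Hx.
  change (Rabs (Im y - Im z) < Rmin (1 / 2) (eps / (4 * c))) in Hy.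
  change (Rabs (Cmod (g y) - Cmod (g z)) < eps).
  assert (H1 := Rmin_l (1 / 2) (eps / (4 * c))). assert (H2 := Rmin_r (1 / 2) (eps / (4 * c))).
  set (m := Rmin (1 / 2) (eps / (4 * c))) in *.
  assert (Hm : Cmod (y - z) <= 2 * m).
  { replace (y - z)%C with (RtoC (Re y - Re z) + Ci * RtoC (Im y - Im z))%C
      by (apply injective_projections; simpl; unfold Re, Im; ring).
    eapply Rle_trans; [apply Cmod_triangle|].
    rewrite Cmod_mult, Cmod_Ci, !Cmod_R. lra. }
  assert (G := Hz (y - z)%C ltac:(lra)).
  assert (E : @eq C (z + (y - z))%C y) by ring. rewrite E in G. clear E.
  assert (K : Cmod (g y - g z) <= c * Cmod (y - z)).
  { replace (g y - g z)%C with ((g y - g z - (y - z) * g' z) + (y - z) * g' z)%C by ring.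
    eapply Rle_trans; [apply Cmod_triangle|]. rewrite Cmod_mult.
    assert (N := Cmod_ge_0 (y - z)).
    assert (B * Cmod (y - z) ^ 2 <= B * Cmod (y - z)).
    { apply Rmult_le_compat_l; [exact HB|]. simpl. rewrite Rmult_1_r.
      rewrite <- (Rmult_1_l (Cmod (y - z))) at 3. apply Rmult_le_compat_r; lra. }
    unfold c. nra. }
  assert (A : Rabs (Cmod (g y) - Cmod (g z)) <= Cmod (g y - g z)).
  { exact (@norm_triangle_inv C_AbsRing C_NormedModule (g y) (g z)). }
  assert (c * Cmod (y - z) <= eps / 2).
  { apply Rle_trans with (c * (2 * (eps / (4 * c)))).
    - apply Rmult_le_compat_l; lra.
    - right. field. lra. }
  generalize (cond_pos eps). lra.
Qed.

Lemma is_derive_pos_increase (f : R -> R) (x l : R) : is_derive f x l -> 0 < l ->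
  exists d, 0 < d /\ forall s, 0 < s < d -> f (x - s) < f x < f (x + s).
Proof.
  intros H Hl. apply is_derive_Reals in H.
  destruct (H l Hl) as [d Hd]. exists d. split; [apply cond_pos|].
  intros s Hs. split.
  - assert (E := Hd (- s) ltac:(lra) ltac:(rewrite Rabs_Ropp, Rabs_pos_eq; lra)).
    apply Rabs_def2 in E. destruct E as [_ E].
    assert (P : 0 < (f (x + - s) - f x) / - s) by lra.
    apply Rmult_lt_compat_r with (r := s) in P; [|lra].
    replace ((f (x + - s) - f x) / - s * s) with (f x - f (x - s)) in P by (unfold Rminus; field; lra).
    lra.
  - assert (E := Hd s ltac:(lra) ltac:(rewrite Rabs_pos_eq; lra)).
    apply Rabs_def2 in E. destruct E as [_ E].
    assert (P : 0 < (f (x + s) - f x) / s) by lra.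
    apply Rmult_lt_compat_r with (r := s) in P; [|lra].
    replace ((f (x + s) - f x) / s * s) with (f (x + s) - f x) in P by (field; lra).
    lra.
Qed.

(** A positive second derivative at a critical point would make the first derivative
    positive just to the right of it, contradicting maximality by the mean value
    theorem. *)
Lemma second_derivative_test (f f' : R -> R) (l d : R) : 0 < d ->
  (forall t, Rabs t < d -> is_derive f t (f' t) /\ f t <= f 0) ->
  is_derive f' 0 l -> l <= 0.
Proof.
  intros Hd Hf Hl.
  assert (H0 := proj1 (Hf 0 ltac:(rewrite Rabs_R0; lra))).
  assert (Hs : forall s, 0 < s < d -> f (0 + s) <= f 0 /\ f (0 - s) <= f 0).
  { intros s Hs. split; apply Hf; [rewrite Rplus_0_l | rewrite Rminus_0_l, Rabs_Ropp];
      rewrite Rabs_pos_eq; lra. }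
  assert (Z : f' 0 = 0).
  { destruct (Rtotal_order (f' 0) 0) as [L|[E|L]]; [|exact E|]; exfalso.
    - assert (H1 : is_derive (fun t => - f t) 0 (- f' 0)) by now apply @is_derive_opp.
      destruct (is_derive_pos_increase _ _ _ H1 ltac:(lra)) as [e [He E]].
      assert (M := Rmin_pos _ _ Hd He). assert (M1 := Rmin_l d e). assert (M2 := Rmin_r d e).
      assert (A := E (Rmin d e / 2) ltac:(lra)). assert (B := Hs (Rmin d e / 2) ltac:(lra)). lra.
    - destruct (is_derive_pos_increase _ _ _ H0 L) as [e [He E]].
      assert (M := Rmin_pos _ _ Hd He). assert (M1 := Rmin_l d e). assert (M2 := Rmin_r d e).
      assert (A := E (Rmin d e / 2) ltac:(lra)). assert (B := Hs (Rmin d e / 2) ltac:(lra)). lra. }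
  destruct (Rle_or_lt l 0) as [|L]; [assumption|exfalso].
  destruct (is_derive_pos_increase _ _ _ Hl L) as [e [He E]].
  assert (M := Rmin_pos _ _ Hd He). assert (M1 := Rmin_l d e). assert (M2 := Rmin_r d e).
  set (s := Rmin d e / 2).
  destruct (MVT_cor2 f f' 0 s) as [c [Ec Hc]].
  - unfold s; lra.
  - intros x Hx. apply is_derive_Reals, Hf. rewrite Rabs_pos_eq; unfold s in Hx; lra.
  - assert (B := proj1 (Hs s ltac:(unfold s; lra))). rewrite Rplus_0_l in B.
    destruct (E c ltac:(unfold s in Hc; lra)) as [_ E']. rewrite Rplus_0_l in E'.
    assert (0 < f' c * (s - 0)) by (apply Rmult_lt_0_compat; lra). lra.
Qed.

Lemma is_derive_ln_comp (f : R -> R) (x l : R) :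
  is_derive f x l -> 0 < f x -> is_derive (fun t => ln (f t)) x (l / f x).
Proof.
  intros H Hp. exact (is_derive_comp ln f x _ _ (is_derive_ln _ Hp) H).
Qed.

(** Second derivative test at [0] for [ln (a c^2 / (b (M - ln b)^2))] along a line. The
    left-hand side is the second derivative of this function, written so that the
    terms which cancel over two orthogonal directions stay visible. *)
Lemma log_quotient_second_derivative (a a' b b' c c' : R -> R) (a2 b2 c2 M d : R) :
  0 < d ->
  (forall t, Rabs t < d ->
     (is_derive a t (a' t) /\ is_derive b t (b' t) /\ is_derive c t (c' t)) /\
     (0 < a t /\ 0 < b t /\ 0 < c t /\ 0 < M - ln (b t)) /\
     ln (a t) - ln (b t) + 2 * ln (c t) - 2 * ln (M - ln (b t))
     <= ln (a 0) - ln (b 0) + 2 * ln (c 0) - 2 * ln (M - ln (b 0))) ->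
  is_derive a' 0 a2 -> is_derive b' 0 b2 -> is_derive c' 0 c2 ->
  (a2 * a 0 - a' 0 * a' 0) / a 0 ^ 2 - (b2 * b 0 - b' 0 * b' 0) / b 0 ^ 2
  + 2 * ((c2 * c 0 - c' 0 * c' 0) / c 0 ^ 2)
  + 2 * (((b2 * b 0 - b' 0 * b' 0) / b 0 ^ 2 * (M - ln (b 0)) + (b' 0 / b 0) ^ 2)
         / (M - ln (b 0)) ^ 2) <= 0.
Proof.
  intros Hd H Ha Hb Hc.
  destruct (H 0 ltac:(rewrite Rabs_R0; lra)) as [[Ha0 [Hb0 Hc0]] [[Pa [Pb [Pc PM]]] _]].
  apply (second_derivative_test
    (fun t => ln (a t) - ln (b t) + 2 * ln (c t) - 2 * ln (M - ln (b t)))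
    (fun t => a' t / a t - b' t / b t + 2 * (c' t / c t)
              - 2 * ((0 - b' t / b t) / (M - ln (b t)))) _ d Hd).
  - intros t Ht. destruct (H t Ht) as [[Da [Db Dc]] [[Qa [Qb [Qc QM]]] Hm]].
    split; [|exact Hm].
    apply @is_derive_minus; [apply @is_derive_plus; [apply @is_derive_minus|]|].
    + now apply is_derive_ln_comp.
    + now apply is_derive_ln_comp.
    + apply is_derive_scal. now apply is_derive_ln_comp.
    + apply is_derive_scal. apply (is_derive_ln_comp (fun t => M - ln (b t))); [|exact QM].
      apply @is_derive_minus; [apply @is_derive_const | now apply is_derive_ln_comp].
  - assert (Eb := is_derive_div b' b 0 _ _ Hb Hb0 ltac:(lra)).
    assert (E : is_derive (fun t => M - ln (b t)) 0 (0 - b' 0 / b 0)).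
    { apply @is_derive_minus; [apply @is_derive_const | now apply is_derive_ln_comp]. }
    assert (E0 : is_derive (fun t => 0 - b' t / b t) 0 (0 - (b2 * b 0 - b' 0 * b' 0) / b 0 ^ 2)).
    { apply @is_derive_minus; [apply @is_derive_const | exact Eb]. }
    evar (l : R).
    match goal with |- is_derive ?f _ ?l0 => assert (T : is_derive f 0 l) end.
    { apply @is_derive_minus; [apply @is_derive_plus; [apply @is_derive_minus|]|].
      + exact (is_derive_div a' a 0 _ _ Ha Ha0 ltac:(lra)).
      + exact Eb.
      + apply is_derive_scal. exact (is_derive_div c' c 0 _ _ Hc Hc0 ltac:(lra)).
      + apply is_derive_scal. exact (is_derive_div _ _ 0 _ _ E0 E ltac:(lra)). }
    match goal with |- is_derive ?f _ ?l0 => replace l0 with l; [exact T|] end.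
    unfold l. unfold minus, plus, opp; simpl.
    field. repeat split; lra.
Qed.

(** The real inner product of the plane: squared moduli and their derivatives are
    expressed with it, which keeps square roots out of the computation. *)
Definition dot (u v : C) : R := Re u * Re v + Im u * Im v.

Lemma dot_self (u : C) : dot u u = Cmod u ^ 2.
Proof.
  unfold dot, Cmod, Re, Im. rewrite pow2_sqrt; [ring|].
  generalize (pow2_ge_0 (fst u)) (pow2_ge_0 (snd u)). lra.
Qed.

Lemma dot_self_pos (u : C) : u <> 0 -> 0 < dot u u.
Proof. intros Hu. rewrite dot_self. apply pow_lt. now apply Cmod_gt_0. Qed.

Lemma is_derive_dot (f g : C -> C) (z d f' g' : C) (t : R) : Cmod d = 1 ->
  has_deriv f (line z d t) f' -> has_deriv g (line z d t) g' ->
  is_derive (fun s => dot (f (line z d s)) (g (line z d s))) t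
    (dot (d * f') (g (line z d t)) + dot (f (line z d t)) (d * g')).
Proof.
  intros Hd Hf Hg.
  destruct (has_deriv_line f z d _ t Hd Hf) as [F1 F2].
  destruct (has_deriv_line g z d _ t Hd Hg) as [G1 G2].
  unfold dot.
  assert (E := is_derive_plus _ _ _ _ _ (Derive.is_derive_mult _ _ _ _ _ F1 G1)
                                 (Derive.is_derive_mult _ _ _ _ _ F2 G2)).
  match type of E with is_derive _ _ ?l0 =>
    match goal with |- is_derive _ _ ?l => replace l with l0; [exact E|] end end.
  unfold plus; simpl. ring.
Qed.

Lemma has_deriv_scal (g : C -> C) (z l c : C) : has_deriv g z l ->
  has_deriv (fun y => (c * g y)%C) z (c * l)%C.
Proof.
  intros [B [HB H]]. exists (Cmod c * B). split.
  { apply Rmult_le_pos; [apply Cmod_ge_0 | exact HB]. }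
  intros k Hk.
  replace (c * g (z + k) - c * g z - k * (c * l))%C
    with (c * (g (z + k) - g z - k * l))%C by ring.
  rewrite Cmod_mult, Rmult_assoc. apply Rmult_le_compat_l; [apply Cmod_ge_0 | now apply H].
Qed.

Lemma has_deriv_id z : has_deriv (fun y => y) z 1.
Proof.
  exists 0. split; [lra|]. intros k _.
  replace (z + k - z - k * 1)%C with (RtoC 0) by ring. rewrite Cmod_0. lra.
Qed.

Lemma has_deriv_const (c z : C) : has_deriv (fun _ => c) z 0.
Proof.
  exists 0. split; [lra|]. intros k _.
  replace (c - c - k * 0)%C with (RtoC 0) by ring. rewrite Cmod_0. lra.
Qed.

Lemma is_derive_dot_self (g g' : C -> C) (z d : C) (t : R) : Cmod d = 1 ->
  (forall y, has_deriv g y (g' y)) ->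
  is_derive (fun s => dot (g (line z d s)) (g (line z d s))) t
    (2 * dot (g (line z d t)) (d * g' (line z d t))).
Proof.
  intros Hd H.
  replace (2 * dot (g (line z d t)) (d * g' (line z d t)))
    with (dot (d * g' (line z d t)) (g (line z d t)) + dot (g (line z d t)) (d * g' (line z d t)))
    by (unfold dot; ring).
  now apply is_derive_dot.
Qed.

Lemma is_derive_dot_self2 (g g' g'' : C -> C) (z d : C) (t : R) : Cmod d = 1 ->
  (forall y, has_deriv g y (g' y)) -> (forall y, has_deriv g' y (g'' y)) ->
  is_derive (fun s => 2 * dot (g (line z d s)) (d * g' (line z d s))) t
    (2 * (dot (d * g' (line z d t)) (d * g' (line z d t))
          + dot (g (line z d t)) (d * (d * g'' (line z d t))))).
Proof.
  intros Hd H H'. apply is_derive_scal.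
  apply (is_derive_dot g (fun y => d * g' y)%C); [exact Hd | apply H|].
  now apply has_deriv_scal.
Qed.

(** * A Schwarz-Pick estimate for logarithmic derivatives *)

Lemma locally_positive (f : R -> R) (l : R) : is_derive f 0 l -> 0 < f 0 ->
  exists d, 0 < d /\ forall t, Rabs t < d -> 0 < f t.
Proof.
  intros H Hp.
  assert (C0 : continuous f 0) by (apply @ex_derive_continuous; now exists l).
  destruct (proj1 (filterlim_locally _ _) C0 (mkposreal _ Hp)) as [d Hd].
  exists d. split; [apply cond_pos|]. intros t Ht.
  assert (B : Rabs (f t - f 0) < f 0).
  { apply (Hd t). change (Rabs (t - 0) < d). now rewrite Rminus_0_r. }
  apply Rabs_def2 in B. lra.
Qed.

Lemma Cmod_line_lt (z d : C) (t r : R) : Cmod d = 1 -> Rabs t < r - Cmod z ->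
  Cmod (line z d t) < r.
Proof.
  intros Hd Ht. unfold line.
  eapply Rle_lt_trans; [apply Cmod_triangle|].
  rewrite Cmod_mult, Cmod_R, Hd. lra.
Qed.

(** Were [g] a logarithm of [h], the function [(M - ln |h|^2) / 2] would be a positive
    real part of the analytic function [M / 2 - g], and the Schwarz-Pick inequality
    for maps from a disc to a half-plane would bound [g' = h1 / h]. No logarithm of
    [h] is available, but Ahlfors' proof of that inequality uses only the derivative
    [h1 / h] and [ln |h|]: one looks at an interior maximum of
    [|h1 / h| * (r^2 - |z|^2) / (M - ln |h|^2)], whose square is [Q] below. The
    functions [ln |h1|] and [ln |h|] are harmonic, so their second derivatives cancel
    in the Laplacian of [ln Q], and what remains is the required inequality. *)
Section SchwarzPick.
Variables (h h1 h2 h3 : C -> C) (r M : R).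
Hypothesis D0 : forall z, has_deriv h z (h1 z).
Hypothesis D1 : forall z, has_deriv h1 z (h2 z).
Hypothesis D2 : forall z, has_deriv h2 z (h3 z).
Hypothesis h_neq_0 : forall z, h z <> 0.
Hypothesis r_pos : 0 < r.
Hypothesis h_lt_M : forall z, Rabs (Re z) <= r -> Rabs (Im z) <= r -> ln (dot (h z) (h z)) < M.

Let V z := M - ln (dot (h z) (h z)).
Let A z := r ^ 2 - dot z z.
Let F z := ln (dot (h1 z) (h1 z)) - ln (dot (h z) (h z)) + 2 * ln (A z) - 2 * ln (V z).

Lemma V_pos z : Cmod z <= r -> 0 < V z.
Proof.
  intros Hz. unfold V.
  assert (L := h_lt_M z (Rle_trans _ _ _ (re_le_Cmod z) Hz) (Rle_trans _ _ _ (im_le_Cmod z) Hz)).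
  lra.
Qed.

Lemma A_pos z : Cmod z < r -> 0 < A z.
Proof.
  intros Hz. unfold A. rewrite dot_self. generalize (Cmod_ge_0 z). nra.
Qed.

(** The second derivative of [F] at a maximum is nonpositive in each unit direction
    [d]. *)
Lemma direction_inequality (m d : C) : Cmod d = 1 -> Cmod m < r -> h1 m <> 0 ->
  (forall z, Cmod z < r -> h1 z <> 0 -> F z <= F m) ->
  let N0 := dot (h m) (h m) in let N1 := dot (h1 m) (h1 m) in
  let B0 := 2 * dot (h m) (d * h1 m) in
  let B1 := 2 * dot (h1 m) (d * h2 m) in
  let S0 := 2 * (dot (d * h1 m) (d * h1 m) + dot (h m) (d * (d * h2 m))) in
  let S1 := 2 * (dot (d * h2 m) (d * h2 m) + dot (h1 m) (d * (d * h3 m))) in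
  (S1 * N1 - B1 * B1) / N1 ^ 2 - (S0 * N0 - B0 * B0) / N0 ^ 2
  + 2 * ((- 2 * A m - (2 * dot m d) * (2 * dot m d)) / A m ^ 2)
  + 2 * (((S0 * N0 - B0 * B0) / N0 ^ 2 * V m + (B0 / N0) ^ 2) / V m ^ 2) <= 0.
Proof.
  intros Hd Hm Hm1 Hmax N0 N1 B0 B1 S0 S1.
  assert (L0 : line m d 0 = m) by (unfold line; ring).
  set (a := fun t => dot (h1 (line m d t)) (h1 (line m d t))).
  assert (Da := fun t => is_derive_dot_self h1 h2 m d t Hd D1). fold a in Da.
  destruct (locally_positive a _ (Da 0)) as [e [He Hea]].
  { unfold a. rewrite L0. now apply dot_self_pos. }
  assert (Hr : 0 < r - Cmod m) by lra.
  assert (P := Rmin_pos _ _ He Hr).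
  assert (T := fun a2 b2 => log_quotient_second_derivative
    a (fun t => 2 * dot (h1 (line m d t)) (d * h2 (line m d t)))
    (fun t => dot (h (line m d t)) (h (line m d t)))
    (fun t => 2 * dot (h (line m d t)) (d * h1 (line m d t)))
    (fun t => r ^ 2 - dot (line m d t) (line m d t))
    (fun t => 0 - 2 * dot (line m d t) (d * 1))
    a2 b2 (0 - 2 * (dot (d * 1) (d * 1) + dot (line m d 0) (d * (d * 0))))
    M (Rmin e (r - Cmod m)) P).
  refine (_ (T _ _ _ (is_derive_dot_self2 h1 h2 h3 m d 0 Hd D1 D2)
               (is_derive_dot_self2 h h1 h2 m d 0 Hd D0 D1) _)).
  - clear T. unfold a. rewrite L0. intros T.
    unfold N0, N1, B0, B1, S0, S1, V, A. eapply Rle_trans; [right|exact T].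
    rewrite !Cmult_1_r, !Cmult_0_r, (dot_self d), Hd.
    replace (dot m 0) with 0 by (unfold dot; simpl; ring).
    unfold Rdiv. simpl pow. ring.
  - intros t Ht.
    assert (H1 := Rmin_l e (r - Cmod m)). assert (H2 := Rmin_r e (r - Cmod m)).
    assert (Hl : Cmod (line m d t) < r) by (apply Cmod_line_lt; [exact Hd | lra]).
    assert (Ha : 0 < a t) by (apply Hea; lra).
    split; [|split].
    + split; [apply Da | split].
      * now apply is_derive_dot_self.
      * apply @is_derive_minus; [apply @is_derive_const|].
        refine (is_derive_dot_self (fun y => y) (fun _ => RtoC 1) m d t Hd _).
        apply has_deriv_id.
    + split; [exact Ha|]. split; [now apply dot_self_pos|]. split.
      * exact (A_pos _ Hl).
      * apply (V_pos (line m d t)). lra.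
    + unfold a. rewrite L0. apply (Hmax (line m d t) Hl).
      intros Hz. unfold a in Ha. rewrite Hz in Ha. unfold dot in Ha. simpl in Ha. lra.
  - apply @is_derive_minus; [apply @is_derive_const|].
    refine (is_derive_dot_self2 (fun y => y) (fun _ => RtoC 1) (fun _ => RtoC 0) m d 0 Hd _ _).
    + apply has_deriv_id.
    + intros y. apply has_deriv_const.
Qed.

(** Adding the inequalities for the directions [1] and [i] gives the Laplacian: the
    derivatives of order two and three of [h] cancel, by harmonicity. *)
Lemma interior_maximum_bound (m : C) : Cmod m < r -> h1 m <> 0 ->
  (forall z, Cmod z < r -> h1 z <> 0 -> F z <= F m) ->
  dot (h1 m) (h1 m) * A m ^ 2 <= r ^ 2 * (dot (h m) (h m) * V m ^ 2).
Proof.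
  intros Hm Hm1 Hmax.
  assert (I1 := direction_inequality m 1 Cmod_1 Hm Hm1 Hmax).
  assert (I2 := direction_inequality m Ci Cmod_Ci Hm Hm1 Hmax).
  assert (P0 := dot_self_pos _ (h_neq_0 m)). assert (P1 := dot_self_pos _ Hm1).
  assert (PV := V_pos m ltac:(lra)). assert (PA := A_pos m Hm).
  cbv zeta in I1, I2.
  assert (I : 2 * (- 4 * r ^ 2) / A m ^ 2
     + 8 * dot (h1 m) (h1 m) / (dot (h m) (h m) * V m ^ 2) <= 0).
  { replace (r ^ 2) with (A m + dot m m) by (unfold A; ring).
    clear Hmax Hm Hm1. revert P0 P1 PV PA I1 I2.
    generalize (V m) (A m) (h m) (h1 m) (h2 m) (h3 m).
    intros v a [h_x h_y] [p_x p_y] [s_x s_y] [t_x t_y] P0 P1 Pv Pa I1 I2.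
    assert (J := Rplus_le_compat _ _ _ _ I1 I2).
    eapply Rle_trans; [right|rewrite Rplus_0_r in J; exact J].
    destruct m as [x y].
    unfold dot, Re, Im in *. simpl in *.
    field. repeat split; lra. }
  revert P0 P1 PV PA I.
  generalize (V m) (A m) (dot (h m) (h m)) (dot (h1 m) (h1 m)).
  intros v a d e Pd Pe Pv Pa I.
  assert (Pv2 : 0 < d * v ^ 2) by (apply Rmult_lt_0_compat; [lra | apply pow_lt; lra]).
  assert (Pa2 : 0 < a ^ 2) by (apply pow_lt; lra).
  assert (J : e / (d * v ^ 2) <= r ^ 2 / a ^ 2) by (unfold Rdiv in *; lra).
  apply Rmult_le_compat_r with (r := d * v ^ 2 * a ^ 2) in J;
    [|left; now apply Rmult_lt_0_compat].
  replace (e / (d * v ^ 2) * (d * v ^ 2 * a ^ 2)) with (e * a ^ 2) in J by (field; split; lra).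
  replace (r ^ 2 / a ^ 2 * (d * v ^ 2 * a ^ 2)) with (r ^ 2 * (d * v ^ 2)) in J by (field; lra).
  exact J.
Qed.

(** The positive part [Rmax 0 (A z)] makes [Q] vanish outside the disc, so that its
    maximum over the square is reached inside the disc. *)
Let Q z := dot (h1 z) (h1 z) * Rmax 0 (A z) ^ 2 * / (dot (h z) (h z) * V z ^ 2).

Lemma Q_continuous (z : C) : Rabs (Re z) <= r -> Rabs (Im z) <= r ->
  @continuous C_UniformSpace R_UniformSpace Q z.
Proof.
  intros Hx Hy.
  assert (Hz : 0 < V z) by (generalize (h_lt_M z Hx Hy); unfold V; lra).
  assert (P0 := dot_self_pos _ (h_neq_0 z)).
  assert (sq : forall f : C -> R, @continuous C_UniformSpace R_UniformSpace f z ->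
    @continuous C_UniformSpace R_UniformSpace (fun y => f y ^ 2) z).
  { intros f Hf. apply (continuous_comp f (fun t => t ^ 2)); [exact Hf|].
    apply continuity_pt_filterlim. reg. }
  assert (cdot : forall g g' : C -> C, (forall y, has_deriv g y (g' y)) ->
    @continuous C_UniformSpace R_UniformSpace (fun y => dot (g y) (g y)) z).
  { intros g g' Hg. apply (continuous_ext (fun y : C_UniformSpace => Cmod (g y) ^ 2)).
    - intros y. now rewrite dot_self.
    - apply sq. exact (continuous_Cmod_has_deriv g g' Hg z). }
  apply (@continuous_mult C_UniformSpace R_AbsRing).
  - apply (@continuous_mult C_UniformSpace R_AbsRing).
    + exact (cdot h1 h2 D1).
    + apply sq. apply (continuous_comp A (Rmax 0)).
      * apply (@continuous_minus C_UniformSpace R_AbsRing R_NormedModule); [apply continuous_const|].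
        exact (cdot (fun y => y) (fun _ => RtoC 1) has_deriv_id).
      * apply (continuous_ext (fun t : R_UniformSpace => (t + Rabs t) / 2)).
        { intros t. unfold Rmax, Rabs. destruct (Rle_dec 0 t), (Rcase_abs t); lra. }
        apply continuity_pt_filterlim. reg.
  - apply (continuous_comp (fun y => dot (h y) (h y) * V y ^ 2) Rinv).
    + apply (@continuous_mult C_UniformSpace R_AbsRing).
      * exact (cdot h h1 D0).
      * apply sq. apply (@continuous_minus C_UniformSpace R_AbsRing R_NormedModule); [apply continuous_const|].
        apply (continuous_comp (fun y => dot (h y) (h y)) ln); [exact (cdot h h1 D0)|].
        apply @ex_derive_continuous. exists (/ dot (h z) (h z)). now apply is_derive_ln.
    + apply continuity_pt_filterlim. apply continuity_pt_inv.
      * apply derivable_continuous_pt, derivable_pt_id.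
      * apply Rgt_not_eq. apply Rmult_lt_0_compat; [exact P0 | now apply pow_lt].
Qed.

Lemma Q_pos (z : C) : Cmod z < r -> h1 z <> 0 -> 0 < Q z /\ ln (Q z) = F z.
Proof.
  intros Hz Hz1.
  assert (P0 := dot_self_pos _ (h_neq_0 z)). assert (P1 := dot_self_pos _ Hz1).
  assert (PV := V_pos z ltac:(lra)). assert (PA := A_pos z Hz).
  unfold Q, F. rewrite Rmax_right by lra.
  assert (0 < V z ^ 2) by now apply pow_lt. assert (0 < A z ^ 2) by now apply pow_lt.
  split.
  - apply Rmult_lt_0_compat; [now apply Rmult_lt_0_compat|].
    apply Rinv_0_lt_compat. now apply Rmult_lt_0_compat.
  - assert (sq : forall t, 0 < t -> ln (t ^ 2) = 2 * ln t).
    { intros t Ht. simpl. rewrite Rmult_1_r, ln_mult by assumption. ring. }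
    assert (PX : 0 < dot (h z) (h z) * V z ^ 2) by now apply Rmult_lt_0_compat.
    rewrite ln_mult, ln_mult, ln_Rinv, ln_mult, !sq by
      (first [assumption | now apply Rmult_lt_0_compat | now apply Rinv_0_lt_compat]).
    ring.
Qed.

Theorem log_derivative_bound (w : C) : Cmod w < r ->
  dot (h1 w) (h1 w) * A w ^ 2 <= r ^ 2 * (dot (h w) (h w) * V w ^ 2).
Proof.
  intros Hw.
  destruct (Ceq_dec (h1 w) 0) as [E|Hw1].
  { rewrite E. unfold dot at 1. simpl Re. simpl Im.
    rewrite !Rmult_0_l, Rplus_0_l, Rmult_0_l.
    apply Rmult_le_pos; [apply pow2_ge_0|].
    apply Rmult_le_pos; [left; apply dot_self_pos, h_neq_0 | apply pow2_ge_0]. }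
  destruct (Q_pos w Hw Hw1) as [Qw _].
  destruct (continuous_max_square Q r (Rlt_le _ _ r_pos) Q_continuous) as [m [[mx my] Hm]].
  assert (in_square : forall z, Cmod z < r -> Q z <= Q m).
  { intros z Hz. apply Hm.
    - generalize (re_le_Cmod z). lra.
    - generalize (im_le_Cmod z). lra. }
  assert (Qm := Rlt_le_trans _ _ _ Qw (in_square w Hw)).
  assert (Hmr : Cmod m < r).
  { apply Rnot_le_lt. intros L. revert Qm. apply Rle_not_lt. right. unfold Q.
    rewrite Rmax_left; [ring|]. unfold A. rewrite dot_self. nra. }
  assert (Hm1 : h1 m <> 0).
  { intros E. revert Qm. apply Rle_not_lt. right. unfold Q. rewrite E. unfold dot at 1. simpl. ring. }
  assert (B := interior_maximum_bound m Hmr Hm1).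
  assert (unfold_Q : forall z, Cmod z < r ->
    Q z <= r ^ 2 <-> dot (h1 z) (h1 z) * A z ^ 2 <= r ^ 2 * (dot (h z) (h z) * V z ^ 2)).
  { intros z Hz. unfold Q. rewrite Rmax_right by (left; now apply A_pos).
    assert (P : 0 < dot (h z) (h z) * V z ^ 2).
    { apply Rmult_lt_0_compat; [apply dot_self_pos, h_neq_0 | apply pow_lt, V_pos; lra]. }
    exact (Rle_div_l _ _ _ P). }
  apply unfold_Q; [exact Hw|].
  eapply Rle_trans; [now apply in_square|].
  apply unfold_Q; [exact Hmr|]. apply B.
  intros z Hz Hz1.
  destruct (Q_pos z Hz Hz1) as [Qz <-]. destruct (Q_pos m Hmr Hm1) as [_ <-].
  destruct (in_square z Hz) as [L|L]; [left; now apply ln_increasing | rewrite L; lra].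
Qed.
End SchwarzPick.

(** * Finitely many zeros force a polynomial *)

(** Let [h] and [h1] be [psum a] and its derivative. The square of half-side [r] lies in
    the disc of radius [2 * r], so minimal type allows a choice of [M] with
    [M - ln |h w|^2 <= 4 * eps * r + c], where [c] is independent of [r], and
    [log_derivative_bound] gives
    [|h1 w| * (r^2 - |w|^2) <= r * |h w| * (4 * eps * r + c)]. As [r] tends to
    infinity, [|h1 w| <= 4 * eps * |h w|] for every positive [eps]. *)
Lemma zero_free_derivative (a : nat -> C) : minimal_type a ->
  (forall z, psum a z <> 0) -> forall w, psum (derived a) w = 0.
Proof.
  intros H Hnz w.
  assert (H' := derived_minimal_type _ H). assert (H'' := derived_minimal_type _ H').
  apply NNPP. intros Hw.
  assert (He := proj1 (Cmod_gt_0 _) Hw). assert (Hd := proj1 (Cmod_gt_0 _) (Hnz w)).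
  set (e := Cmod (psum (derived a) w)) in *. set (d := Cmod (psum a w)) in *.
  set (n := Cmod w). assert (Hn : 0 <= n) by apply Cmod_ge_0.
  (* makes the limiting bound [4 * eps * d] equal to [e / 4] *)
  set (eps := e / (16 * d)).
  assert (Heps : 0 < eps) by (apply Rdiv_lt_0_compat; lra).
  destruct (H eps Heps) as [K HK].
  assert (KP : 0 < K).
  { destruct (exp_bounded_ge0 _ _ _ HK) as [|E]; [assumption|]. exfalso.
    assert (B := proj2 (psum_exp_bounded _ _ _ w HK)). fold d in B. rewrite <- E in B. lra. }
  set (c := Rabs (2 * ln K + 1 - ln (dot (psum a w) (psum a w)))).
  assert (Hc : 0 <= c) by apply Rabs_pos.
  (* as [2 * n <= r], the term [e * n ^ 2] is at most a quarter of [e * r ^ 2]; the last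
     summand makes the remaining half of [e * r ^ 2] exceed [r * d * c] *)
  set (r := 2 * n + 1 + 2 * (d * c) / e).
  assert (Hdc : 0 <= d * c) by (apply Rmult_le_pos; lra).
  assert (Hq : 0 <= 2 * (d * c) / e) by (apply Rdiv_le_0_compat; lra).
  assert (Hr : 2 * n + 1 <= r) by (unfold r; lra).
  assert (E : e * r = e * (2 * n + 1) + 2 * (d * c)) by (unfold r; field; lra).
  set (M := 2 * ln K + 4 * eps * r + 1).
  assert (HM : forall z, Rabs (Re z) <= r -> Rabs (Im z) <= r ->
            ln (dot (psum a z) (psum a z)) < M).
  { intros z Hx Hy. assert (P := proj1 (Cmod_gt_0 _) (Hnz z)).
    assert (Hz : Cmod z <= 2 * r).
    { replace z with (RtoC (Re z) + Ci * RtoC (Im z))%C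
        by (apply injective_projections; simpl; unfold Re, Im; ring).
      eapply Rle_trans; [apply Cmod_triangle|].
      rewrite Cmod_mult, Cmod_Ci, !Cmod_R. lra. }
    assert (B := proj2 (psum_exp_bounded _ _ _ z HK)).
    apply (fun A => ln_le _ _ A B) in P.
    rewrite ln_mult, ln_exp in P by (assumption || apply exp_pos).
    rewrite dot_self. simpl pow. rewrite Rmult_1_r, ln_mult by (apply Cmod_gt_0, Hnz).
    assert (eps * Cmod z <= eps * (2 * r)) by (apply Rmult_le_compat_l; lra).
    unfold M. lra. }
  assert (B := log_derivative_bound (psum a) (psum (derived a)) (psum (derived (derived a)))
    (psum (derived (derived (derived a)))) r M
    (fun z => psum_has_deriv _ z H) (fun z => psum_has_deriv _ z H')
    (fun z => psum_has_deriv _ z H'') Hnz ltac:(lra) HM w ltac:(fold n; lra)).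
  assert (HV := HM w ltac:(generalize (re_le_Cmod w); fold n; lra)
                     ltac:(generalize (im_le_Cmod w); fold n; lra)).
  assert (HV' : M - ln (dot (psum a w) (psum a w)) <= 4 * eps * r + c).
  { unfold M, c. generalize (Rle_abs (2 * ln K + 1 - ln (dot (psum a w) (psum a w)))). lra. }
  set (V := M - ln (dot (psum a w) (psum a w))) in *.
  rewrite !dot_self in B. fold e d n in B.
  assert (B' : e * (r ^ 2 - n ^ 2) <= r * (d * V)).
  { apply Rsqr_incr_0_var.
    - unfold Rsqr. nra.
    - apply Rmult_le_pos; [lra|]. apply Rmult_le_pos; unfold V; lra. }
  assert (B2 : r * (d * V) <= r * (d * (4 * eps * r + c))).
  { apply Rmult_le_compat_l; [lra|]. apply Rmult_le_compat_l; lra. }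
  replace (r * (d * (4 * eps * r + c))) with (e * r ^ 2 / 4 + r * (d * c)) in B2
    by (unfold eps; field; lra).
  assert (N2 : n ^ 2 <= r ^ 2 / 4) by nra.
  assert (e * n ^ 2 <= e * (r ^ 2 / 4)) by (apply Rmult_le_compat_l; lra).
  assert (B3 : (e * r) * r <= 2 * (d * c) * r) by nra.
  apply Rmult_le_reg_r in B3; [|lra]. nra.
Qed.

Lemma zero_free_constant (a : nat -> C) : minimal_type a ->
  (forall z, psum a z <> 0) -> forall n, a (S n) = 0.
Proof.
  intros H Hnz n.
  apply derived_eq_0.
  exact (psum_zero_coef _ (derived_minimal_type a H) (zero_free_derivative a H Hnz) n).
Qed.

Lemma least_witness (P : nat -> Prop) : (exists n, P n) ->
  exists n, P n /\ forall k, (k < n)%nat -> ~ P k.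
Proof.
  intros [n Hn]. revert Hn. induction n as [n IH] using (well_founded_induction Wf_nat.lt_wf).
  intros Hn. destruct (classic (exists k, (k < n)%nat /\ P k)) as [[k [Hk Pk]]|N].
  - now apply (IH k).
  - exists n. split; [exact Hn|]. intros k Hk Pk. apply N. now exists k.
Qed.

Definition eventually_zero (a : nat -> C) : Prop :=
  exists N, forall n, (N <= n)%nat -> a n = 0.

Lemma divided_eventually_zero a w : minimal_type a ->
  eventually_zero (divided w a) -> eventually_zero a.
Proof.
  intros H [N HN]. exists (S N). intros [|n] Hn; [lia|].
  assert (E := divided_rec a w n H).
  rewrite !HN in E by lia. rewrite Cmult_0_r, Cplus_0_r in E. now symmetry.
Qed.

Lemma divided_iter_eventually_zero a w m : minimal_type a ->
  eventually_zero (divided_iter w m a) -> eventually_zero a.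
Proof.
  intros H. induction m as [|m IH]; simpl; [auto|].
  intros E. apply IH. revert E. apply divided_eventually_zero.
  now apply divided_iter_minimal_type.
Qed.

(** Induction on the zero set: dividing by [z - x] as often as [x] is a zero removes
    [x] and keeps minimal type; this stops by [infinite_order_zero] unless
    [psum a] vanishes identically. Without zeros, the function is constant. *)
Theorem finitely_many_zeros_polynomial (Z : C -> Prop) : Finite_sets.Finite C Z ->
  forall a, minimal_type a -> (forall z, psum a z = 0 -> Z z) -> eventually_zero a.
Proof.
  induction 1 as [|A FA IH x Hx]; intros a H Hz.
  - exists 1%nat. intros [|n] Hn; [lia|].
    apply zero_free_constant; [exact H|]. intros z E. destruct (Hz z E).
  - destruct (classic (exists m, psum (divided_iter x m a) x <> 0)) as [E|N].
    + apply least_witness in E. destruct E as [m [Hm Hk]].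
      apply (divided_iter_eventually_zero a x m H).
      apply IH; [now apply divided_iter_minimal_type|].
      intros z E.
      assert (Ez : psum a z = 0).
      { rewrite (psum_divided_iter a x z m H).
        - rewrite E. apply Cmult_0_r.
        - intros k L. apply NNPP. now apply Hk. }
      destruct (Hz z Ez) as [z Az|z Xz]; [exact Az|].
      destruct Xz. contradiction.
    + exists 0%nat. intros n _. apply (psum_zero_coef a H).
      apply (infinite_order_zero a x H). intros m.
      apply NNPP. intros Nm. apply N. now exists m.
Qed.

(** * The coefficients of the series *)

Lemma Cmod_Cexp (w : C) : Cmod (Cexp w) = exp (Re w).
Proof.
  unfold Cexp. rewrite Cmod_mult, Cmod_R, Rabs_pos_eq by (left; apply exp_pos).
  unfold Cmod. simpl.
  replace (cos (Im w) * (cos (Im w) * 1) + sin (Im w) * (sin (Im w) * 1)) with 1.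
  - rewrite sqrt_1. ring.
  - generalize (sin2_cos2 (Im w)). unfold Rsqr. lra.
Qed.

Lemma Cmod_fact_Cpower (n : nat) (r : C) :
  Cmod (fact_Cpower n r) = exp (Re r * ln (INR (fact n))).
Proof.
  unfold fact_Cpower. rewrite Cmod_Cexp. f_equal. unfold Re. simpl. ring.
Qed.

Lemma fact_Cpower_neq_0 (n : nat) (r : C) : fact_Cpower n r <> 0.
Proof.
  apply Cmod_gt_0. rewrite Cmod_fact_Cpower. apply exp_pos.
Qed.

Lemma pow_le_fact_exp (A : R) (n : nat) : 0 <= A -> A ^ n <= INR (fact n) * exp A.
Proof.
  intros HA.
  assert (B : A ^ n / INR (fact n) <= exp A).
  { eapply Rle_trans; [|exact (exp_ge_taylor A n HA)].
    destruct n as [|n]; [simpl; lra|]. rewrite tech5.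
    assert (0 <= sum_f_R0 (fun k => A ^ k / INR (fact k)) n); [|lra].
    apply cond_pos_sum. intros k. now apply pow_div_fact_ge0. }
  apply Rle_div_l in B; [|apply INR_fact_lt_0]. lra.
Qed.

(** With [s = Re r - 1 > 0], the claim is [(n!) ^ (- s) <= K * eps ^ n]. Raising
    [A ^ n <= n! * exp A] to the power [s] gives it for [A = eps ^ (- 1 / s)] and
    [K = exp (s * A)]. *)
Lemma inv_fact_Cpower_minimal_type (r : C) : 1 < Re r ->
  minimal_type (fun n => (/ fact_Cpower n r)%C).
Proof.
  intros Hr eps He.
  set (s := Re r - 1). assert (Hs : 0 < s) by (unfold s; lra).
  set (A := exp (- ln eps / s)). exists (exp (s * A)). intros n.
  assert (F := INR_fact_lt_0 n).
  rewrite Cmod_inv, Cmod_fact_Cpower, <- exp_Ropp by apply fact_Cpower_neq_0.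
  assert (L : INR n * (- ln eps / s) <= ln (INR (fact n)) + A).
  { rewrite <- (ln_exp A) at 1. rewrite <- ln_mult by (assumption || apply exp_pos).
    assert (B := pow_le_fact_exp A n (Rlt_le _ _ (exp_pos _))).
    apply ln_le in B; [|apply pow_lt, exp_pos].
    rewrite ln_pow in B by apply exp_pos. unfold A at 1 in B. now rewrite ln_exp in B. }
  apply Rmult_le_compat_l with (r := s) in L; [|lra].
  replace (s * (INR n * (- ln eps / s))) with (- (INR n * ln eps)) in L by (field; lra).
  replace (eps ^ n / INR (fact n)) with (exp (INR n * ln eps - ln (INR (fact n)))).
  - rewrite <- exp_plus.
    assert (X : - (Re r * ln (INR (fact n))) <= s * A + (INR n * ln eps - ln (INR (fact n)))).
    { replace (Re r) with (s + 1) by (unfold s; ring). lra. }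
    destruct X as [X|X]; [left; now apply exp_increasing | rewrite X; lra].
  - unfold Rminus. rewrite exp_plus, exp_Ropp, exp_ln by exact F.
    rewrite <- ln_pow by exact He. rewrite exp_ln by now apply pow_lt. reflexivity.
Qed.

Open Scope C_scope.

Theorem theorem3p1 :
  forall r : C, (1 < Re r)%R ->
    (forall z : C, @is_series C_AbsRing C_NormedModule (fr_term r z) (fr r z)) /\
    entire (fr r) /\
    ~ Finite_sets.Finite C (fun z : C => fr r z = 0).
Proof.
  intros r Hr.
  set (a := fun n => / fact_Cpower n r).
  assert (H : minimal_type a) by now apply inv_fact_Cpower_minimal_type.
  assert (E : forall z, fr r z = psum a z).
  { intros z. apply CSeries_ext. intros n. apply Cmult_comm. }
  split; [|split].
  - intros z. rewrite E. refine (is_series_ext _ _ _ _ (psum_is_series a z H)).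
    intros n. apply Cmult_comm.
  - intros z. exists (psum (derived a) z).
    apply (is_derive_ext (psum a)); [intros y; now rewrite E|].
    apply has_deriv_is_derive. now apply psum_has_deriv.
  - intros F.
    destruct (finitely_many_zeros_polynomial _ F a H) as [N HN].
    + intros z Hz. now rewrite E.
    + assert (X := HN N (le_n N)). revert X. apply Cmod_gt_0. unfold a.
      rewrite Cmod_inv by apply fact_Cpower_neq_0.
      apply Rinv_0_lt_compat. apply Cmod_gt_0, fact_Cpower_neq_0.
Qed.
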